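(* If $\chi=(P,Q,R)$ is a quadratic vector field on $\mathbb{T}^2$, then $P,Q,R$ satisfy $$P=\tfrac{\alpha}{4}xz+fy,\qquad Q=\tfrac{\alpha}{4}yz-fx,\qquad R=\tfrac{\alpha}{2}\big(-a^2(x^2+y^2)+z^2+a^4-1\big),$$ where $\alpha\in\mathbb{R}$ and $f\in\mathbb{R}[x,y,z]$ is a linear polynomial.
   Context: Fix a real number $a>1$ and let $\mathbb{T}^2=\{(x,y,z)\in\mathbb{R}^3:(x^2+y^2-a^2)^2+z^2-1=0\}$. A triple $\chi=(P,Q,R)$ with $P,Q,R\in\mathbb{R}[x,y,z]$ denotes the polynomial vector field $P\frac{\partial}{\partial x}+Q\frac{\partial}{\partial y}+R\frac{\partial}{\partial z}$ in $\mathbb{R}^3$, acting on polynomials as a derivation; its degree is $\max\{\deg P,\deg Q,\deg R\}$, and it is quadratic if its degree is $2$. It is called a vector field on $\mathbb{T}^2$ if $\chi F=KF$ for some $K\in\mathbb{R}[x,y,z]$, where $F=(x^2+y^2-a^2)^2+z^2-1$. Here ''linear polynomial'' means a polynomial of degree at most $1$ (a constant term is allowed, and constants, including zero, are allowed). *)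

(* Defs.v *)
From HB Require Import structures.
From mathcomp Require Import all_boot all_order all_algebra.
From mathcomp Require Import reals.
From mathcomp Require Import mpoly.

Set Implicit Arguments.
Unset Strict Implicit.
Unset Printing Implicit Defensive.

Import Order.TTheory GRing.Theory Num.Theory.

Local Open Scope ring_scope.

Definition ix : 'I_3 := @Ordinal 3 0 isT.
Definition iy : 'I_3 := @Ordinal 3 1 isT.
Definition iz : 'I_3 := @Ordinal 3 2 isT.

Section PolyVectorFields.
Variable R : realType.
Implicit Types p q : {mpoly R[3]}.

(* [msize p] is 1 + the total degree; the zero polynomial gets degree 0. *)
Definition pdeg p : nat := (msize p).-1.

(* P d/dx + Q d/dy + R d/dz, stored by its three components. *)
Record poly_vf := PolyVF {
  vfP : {mpoly R[3]};
  vfQ : {mpoly R[3]};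
  vfR : {mpoly R[3]}
}.

Definition vf_act (chi : poly_vf) p : {mpoly R[3]} :=
  vfP chi * p^`M(ix) + vfQ chi * p^`M(iy) + vfR chi * p^`M(iz).

Definition vf_degree (chi : poly_vf) : nat :=
  maxn (pdeg (vfP chi)) (maxn (pdeg (vfQ chi)) (pdeg (vfR chi))).

Definition quadratic_vf (chi : poly_vf) : Prop := vf_degree chi = 2.

Definition linear_poly p : Prop := (pdeg p <= 1)%N.

Definition torus_poly (a : R) : {mpoly R[3]} :=
  ('X_ix ^+ 2 + 'X_iy ^+ 2 - (a ^+ 2)%:MP) ^+ 2 + 'X_iz ^+ 2 - 1.

Definition vf_on_torus (a : R) (chi : poly_vf) : Prop :=
  exists K : {mpoly R[3]}, vf_act chi (torus_poly a) = K * torus_poly a.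

End PolyVectorFields.

(* Main.v *)
(** Write S = x^2 + y^2 - a^2, so that F = S^2 + z^2 - 1, and A = x P + y Q; the
    hypothesis reads 4 S A + 2 z W = K (S^2 + z^2 - 1), and deg K <= 1 for degree
    reasons.  At z = 0 this gives S (K S - 4 A) = K, so K vanishes at z = 0 (S has
    degree 2) and so does A: K = k z with k constant and A = z B.  Dividing by z,
    S (4 B - k S) = k (z^2 - 1) - 2 W has degree at most 2, so 4 B - k S is a
    constant, equal to k a^2 because A, hence B, vanishes on the z-axis.  This
    determines W, and 4 A = k z (x^2 + y^2) says that
    x (4 P - k x z) + y (4 Q - k y z) = 0, which produces f. *)
Require Import Defs.
From mathcomp Require Import all_boot all_order all_algebra.
From mathcomp Require Import reals.
From mathcomp Require Import mpoly.
From mathcomp Require Import zify ring.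

Import Order.TTheory GRing.Theory Num.Theory.

Local Open Scope ring_scope.

(** * Degree bounds, with [msize] equal to the degree plus one for nonzero polynomials *)

Lemma msizeM_leS n (R : idomainType) k l (p q : {mpoly R[n]}) :
  (msize p <= k.+1)%N -> (msize q <= l.+1)%N -> (msize (p * q) <= (k + l).+1)%N.
Proof.
have [->|p0] := eqVneq p 0; first by rewrite mul0r msize0.
have [->|q0] := eqVneq q 0; first by rewrite mulr0 msize0.
by rewrite msizeM //; lia.
Qed.

Lemma msizeD_leS n (R : idomainType) k (p q : {mpoly R[n]}) :
  (msize p <= k)%N -> (msize q <= k)%N -> (msize (p + q) <= k)%N.
Proof.
by move=> pk qk; apply: leq_trans (msizeD_le _ _) _; rewrite geq_max pk.
Qed.

Lemma msizeC_le1 n (R : nzRingType) (c : R) : (msize (c%:MP : {mpoly R[n]}) <= 1)%N.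
Proof. by rewrite msizeC leq_b1. Qed.

Lemma msizeX_leS n (R : idomainType) k m (p : {mpoly R[n]}) :
  (msize p <= k.+1)%N -> (msize (p ^+ m) <= (k * m).+1)%N.
Proof.
move=> pk; elim: m => [|m IH]; first by rewrite expr0 msize1.
by rewrite exprS mulnS; apply: msizeM_leS.
Qed.

Lemma msize_prod_leS n (R : idomainType) (I : Type) (r : seq I)
    (F : I -> {mpoly R[n]}) (k : I -> nat) :
  (forall i, msize (F i) <= (k i).+1)%N ->
  (msize (\prod_(i <- r) F i) <= (\sum_(i <- r) k i).+1)%N.
Proof.
move=> Fk; elim: r => [|i r IH]; first by rewrite !big_nil msize1.
by rewrite !big_cons; apply: msizeM_leS.
Qed.

(** Degrees add over a domain. The case [k = 0] is allowed and then forces [q = 0]. *)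
Lemma msize_cofactor n (R : idomainType) k l (p q : {mpoly R[n]}) :
  (l < msize p)%N -> (msize (p * q) <= k + l)%N -> (msize q <= k)%N.
Proof.
have [->|p0] := eqVneq p 0; first by rewrite msize0.
have [->|q0] := eqVneq q 0; first by rewrite msize0.
by rewrite msizeM //; lia.
Qed.

(** A monomial of degree d is sent to a product of d factors, each of degree at most 1. *)
Lemma msize_comp_mpoly n (R : idomainType) k (lq : n.-tuple {mpoly R[k]}) p :
  (forall i, msize (tnth lq i) <= 2)%N -> (msize (p \mPo lq) <= msize p)%N.
Proof.
move=> lq2; rewrite comp_mpolyE; apply: leq_trans (msize_sum _ _ _) _.
apply/bigmax_leqP_seq => m mp _; apply: leq_trans (msizeZ_le _ _) _.
apply: leq_trans (msize_mdeg_lt mp); rewrite mdegE.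
apply: msize_prod_leS => i.
by rewrite -{2}[m i]mul1n; apply: msizeX_leS.
Qed.

(** * Setting one variable to zero, and divisibility by that variable *)

Notation mzero i := (comp_mpoly [tuple if j == i then 0 else 'X_j | j < _]).

Lemma mzeroX n (R : idomainType) (i j : 'I_n) :
  mzero i ('X_j : {mpoly R[n]}) = if j == i then 0 else 'X_j.
Proof. by rewrite comp_mpolyXU -tnth_nth tnth_mktuple. Qed.

Lemma msize_mzero n (R : idomainType) (i : 'I_n) (p : {mpoly R[n]}) :
  (msize (mzero i p) <= msize p)%N.
Proof.
apply: msize_comp_mpoly => j; rewrite tnth_mktuple.
by case: eqP => _; rewrite ?msize0 // msizeX mdeg1.
Qed.

Lemma mzero_decomp n (R : idomainType) (i : 'I_n) (p : {mpoly R[n]}) :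
  exists q, p = mzero i p + 'X_i * q.
Proof.
(* The property holds for constants and variables and is stable under sums and products, hence holds
   for every polynomial. *)
pose D (p : {mpoly R[n]}) := exists q, p = mzero i p + 'X_i * q.
have DD p1 p2 : D p1 -> D p2 -> D (p1 + p2).
  move=> [q1 e1] [q2 e2]; exists (q1 + q2).
  by rewrite rmorphD mulrDr addrACA -e1 -e2.
have DM p1 p2 : D p1 -> D p2 -> D (p1 * p2).
  move=> [q1 e1] [q2 e2]; exists (q1 * p2 + mzero i p1 * q2).
  rewrite rmorphM /=; move: (mzero i p1) (mzero i p2) e1 e2 => z1 z2 -> ->; ring.
have DC c : D c%:MP by exists 0; rewrite comp_mpolyC mulr0 addr0.
have DX j : D 'X_j.
  rewrite /D mzeroX; case: eqP => [->|_]; first by exists 1; rewrite mulr1 add0r.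
  by exists 0; rewrite mulr0 addr0.
elim/mpolyind: p => [|c m p _ _]; first exact: (DC 0).
apply: DD; rewrite -mul_mpolyC; apply: (DM) (DC c) _.
rewrite mpolyXE_id; elim/big_ind: _ => [||j _]; [exact: (DC 1)|exact: DM|].
elim: (m j) => [|k IH]; [exact: (DC 1)|by rewrite exprS; apply: DM].
Qed.

Lemma mzero_factor n (R : idomainType) (i : 'I_n) (p : {mpoly R[n]}) :
  mzero i p = 0 -> exists q, p = 'X_i * q.
Proof. by have [q e] := mzero_decomp n R i p => h; exists q; rewrite e h add0r. Qed.

(** * The torus polynomial: its degree and its image under a vector field *)

Lemma mpolyX_neq0 n (R : idomainType) (i : 'I_n) : 'X_i != 0 :> {mpoly R[n]}.
Proof. by rewrite -msize_poly_eq0 msizeX. Qed.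

Lemma msizeU n (R : idomainType) (i : 'I_n) : msize ('X_i : {mpoly R[n]}) = 2.
Proof. by rewrite msizeX mdeg1. Qed.

Lemma msize_circle (R : realType) (c : R) :
  msize ('X_ix ^+ 2 + 'X_iy ^+ 2 - c%:MP : {mpoly R[3]}) = 3.
Proof.
apply/eqP; rewrite eqn_leq; apply/andP; split.
  apply: msizeD_leS; last by rewrite msizeN (leq_trans (msizeC_le1 _ _ _)).
  by apply: msizeD_leS; rewrite mpolyXn msizeX mdegMn mdeg1.
(* The lower bound comes from the monomial x^2, whose coefficient is 1. *)
rewrite -[X in (X < _)%N](_ : mdeg (U_(ix) *+ 2)%MM = 2%N); last first.
  by rewrite mdegMn mdeg1.
apply: msize_mdeg_lt; rewrite mcoeff_msupp !mcoeffB !mcoeffD !mpolyXn !mcoeffX.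
rewrite eqxx mcoeffC.
have -> : (U_(iy) *+ 2)%MM == (U_(ix) *+ 2)%MM = false :> bool.
  by apply/eqP => /mnmP /(_ ix); rewrite !mulmnE !mnm1E.
have -> : (U_(ix) *+ 2)%MM == 0%MM = false :> bool.
  by apply/eqP => /mnmP /(_ ix); rewrite !mulmnE !mnm1E mnm0E.
by rewrite addr0 mulr0 subr0 oner_neq0.
Qed.

(** Since S^2 = F + (1 - z^2) has degree 4 and 1 - z^2 has degree 2, F cannot have degree below
    4. *)
Lemma msize_torus (R : realType) (a : R) : (4 < msize (torus_poly a))%N.
Proof.
rewrite /torus_poly; set S := _ - (a ^+ 2)%:MP.
have S3 : msize S = 3 by exact: msize_circle.
have S0 : S != 0 by rewrite -msize_poly_eq0 S3.
have S5 : msize (S ^+ 2) = 5 by rewrite expr2 msizeM // S3.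
rewrite ltnNge; apply/negP => F4.
suff : (msize (S ^+ 2) <= 4)%N by rewrite S5.
have -> : S ^+ 2 = S ^+ 2 + 'X_iz ^+ 2 - 1 + (1 - 'X_iz ^+ 2) by ring.
apply: msizeD_leS => //; apply: msizeD_leS; first by rewrite msize1.
by rewrite msizeN mpolyXn msizeX mdegMn mdeg1.
Qed.

Lemma mderivU n (R : nzRingType) (i j : 'I_n) :
  ('X_j : {mpoly R[n]})^`M(i) = (j == i)%:R.
Proof.
rewrite mderivX mnm1E; case: eqP => [->|_]; last by rewrite scale0r.
rewrite (_ : U_(i) - U_(i) = 0)%MM ?mpolyX0 ?scale1r //.
by apply/mnmP => k; rewrite mnmBE mnm0E subnn.
Qed.

Lemma vf_act_torus (R : realType) (a : R) (P Q W : {mpoly R[3]}) :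
  vf_act (PolyVF P Q W) (torus_poly a) =
  4%:R * ('X_ix ^+ 2 + 'X_iy ^+ 2 - (a ^+ 2)%:MP) * ('X_ix * P + 'X_iy * Q)
  + 2%:R * 'X_iz * W.
Proof.
rewrite /vf_act /torus_poly /= -mpolyC1 !expr2.
rewrite !(mderivB, mderivD, mderivM, mderivU, mderivC) /=; ring.
Qed.

Theorem corollary4p2 (R : realType) (a : R) (ha : 1 < a)
    (P Q W : {mpoly R[3]})
    (hquad : quadratic_vf (PolyVF P Q W))
    (htorus : vf_on_torus a (PolyVF P Q W)) :
  exists (alpha : R) (f : {mpoly R[3]}),
    [/\ linear_poly f,
        P = (alpha / 4%:R) *: ('X_ix * 'X_iz) + f * 'X_iy,
        Q = (alpha / 4%:R) *: ('X_iy * 'X_iz) - f * 'X_ix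
      & W = (alpha / 2%:R) *:
              (- (a ^+ 2) *: ('X_ix ^+ 2 + 'X_iy ^+ 2)
               + 'X_iz ^+ 2 + (a ^+ 4 - 1)%:MP)].
Proof.
have [P3 Q3 W3] : [/\ msize P <= 3, msize Q <= 3 & msize W <= 3]%N.
  by move: hquad; rewrite /quadratic_vf /vf_degree /pdeg /= => h; split; lia.
have U2 i : (msize ('X_i : {mpoly R[3]}) <= 2)%N by rewrite msizeU.
have X0 i : 'X_i != 0 :> {mpoly R[3]} := mpolyX_neq0 _ _ i.
have nat1 k : (msize (k%:R : {mpoly R[3]}) <= 1)%N.
  by rewrite -mpolyC_nat msizeC_le1.
have [K hK] := htorus; have := msize_torus R a; move: hK.
rewrite vf_act_torus /torus_poly; set S := _ - (a ^+ 2)%:MP; set A := _ + _ * Q.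
move=> hK F5.
have S3 : msize S = 3 by exact: msize_circle.
have S0 : S != 0 by rewrite -msize_poly_eq0 S3.
have A4 : (msize A <= 4)%N.
  by apply: msizeD_leS; apply: (@msizeM_leS _ _ 1 2).
(* The left side of [hK] has degree at most 2 + 3 = 5, and F has degree at least 4. *)
have K2 : (msize K <= 2)%N.
  apply: msize_cofactor F5 _; rewrite mulrC -hK; apply: msizeD_leS.
    apply: (@msizeM_leS _ _ 2 3) => //; apply: (@msizeM_leS _ _ 0 2) => //.
    by rewrite S3.
  apply: (@leq_trans 4) => //; apply: (@msizeM_leS _ _ 1 2) => //.
  exact: (@msizeM_leS _ _ 0 1).
have Sz : mzero iz S = S.
  by rewrite /S rmorphB rmorphD !rmorphXn /= !mzeroX comp_mpolyC.
have hz : S * (mzero iz K * S - 4%:R * mzero iz A) = mzero iz K.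
  (* With [S] and [A] opaque, the morphism rules stop at them instead of expanding them. *)
  clearbody S A; have /(congr1 (mzero iz)) := hK.
  rewrite !(rmorph_nat, rmorphD, rmorphN, rmorphM, rmorphXn, rmorph1) /= Sz.
  rewrite mzeroX /= => hKz.
  transitivity (mzero iz K * S ^+ 2 - 4%:R * S * mzero iz A); first ring.
  have -> : 4%:R * S * mzero iz A = mzero iz K * (S ^+ 2 - 1).
    by move: hKz; rewrite !expr2 !(mulr0, mul0r, addr0).
  ring.
have Kz0 : mzero iz K = 0.
  (* Here [k = 0] in [msize_cofactor]: a multiple of S of degree at most 1 has cofactor zero. *)
  have : (msize (mzero iz K * S - 4%:R * mzero iz A) <= 0)%N.
    apply: (@msize_cofactor _ _ 0 2 S); rewrite ?S3 // hz.
    exact: leq_trans (msize_mzero _ _ _ _) K2.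
  by rewrite leqn0 msize_poly_eq0 => /eqP h; rewrite -hz h mulr0.
have Az0 : mzero iz A = 0.
  move/eqP: hz; rewrite Kz0 mul0r sub0r mulf_eq0 (negbTE S0) oppr_eq0 mulf_eq0.
  rewrite -mpolyC_nat mpolyC_eq0 pnatr_eq0 /=; exact: eqP.
have [k hk] := mzero_factor _ _ _ _ Kz0.
have [B hB] := mzero_factor _ _ _ _ Az0.
have k1 : (msize k <= 1)%N.
  by apply: (@msize_cofactor _ _ 1 1 'X_iz); rewrite ?msizeU -?hk.
have B3 : (msize B <= 3)%N.
  by apply: (@msize_cofactor _ _ 3 1 'X_iz); rewrite ?msizeU -?hB.
have hB2 : 4%:R * S * B + 2%:R * W = k * (S ^+ 2 + 'X_iz ^+ 2 - 1).
  apply: (mulfI (X0 iz)); transitivity (4%:R * S * A + 2%:R * 'X_iz * W).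
    by rewrite hB; ring.
  by rewrite hK hk; ring.
have hl : S * (4%:R * B - k * S) = k * ('X_iz ^+ 2 - 1) - 2%:R * W.
  transitivity (4%:R * S * B + 2%:R * W - k * S ^+ 2 - 2%:R * W); first ring.
  by rewrite hB2; ring.
have : (msize (4%:R * B - k * S) <= 1)%N.
  apply: (@msize_cofactor _ _ 1 2 S); rewrite ?S3 // hl.
  apply: msizeD_leS; rewrite ?msizeN.
    apply: (@msizeM_leS _ _ 0 2) => //; apply: msizeD_leS.
      by rewrite mpolyXn msizeX mdegMn mdeg1.
    by rewrite msizeN msize1.
  exact: (@msizeM_leS _ _ 0 2).
(* Both polynomials of size at most 1 are constants, named by their constant coefficients [k0] and
   [l]. *)
move: k1 => /msize1_polyC; move: (k@_0) => k0 hk0 /msize1_polyC; move: (_@_0) => l hl0.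

have hl1 : 4%:R * B = k * S + l%:MP by rewrite -hl0; ring.
have hlk : l%:MP = k * (a ^+ 2)%:MP.
  (* [e] restricts to the z-axis, where S becomes -a^2. *)
  pose e (p : {mpoly R[3]}) := mzero ix (mzero iy p).
  have eD p q : e (p + q) = e p + e q by rewrite /e !rmorphD.
  have eM p q : e (p * q) = e p * e q by rewrite /e !rmorphM.
  have eC c : e c%:MP = c%:MP by rewrite /e !comp_mpolyC.
  have ex : e 'X_ix = 0 by rewrite /e !mzeroX.
  have ey : e 'X_iy = 0 by rewrite /e mzeroX /= rmorph0.
  have ez : e 'X_iz = 'X_iz by rewrite /e !mzeroX.
  have B0 : e B = 0.
    apply: (mulfI (X0 iz)); rewrite mulr0 -ez -eM -hB /A eD !eM ex ey.
    by rewrite !mul0r addr0.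
  have := congr1 e hl1.
  rewrite /S hk0 -mpolyC_nat -mpolyCN !expr2 !(eD, eM, eC) B0 ex ey mpolyCN.
  move=> h; apply/eqP; rewrite -subr_eq0; apply/eqP.
  transitivity ((4%:R)%:MP * 0 : {mpoly R[3]}); last exact: mulr0.
  by rewrite h; ring.
have hA : 4%:R * A = k * 'X_iz * ('X_ix ^+ 2 + 'X_iy ^+ 2).
  by rewrite hB mulrCA hl1 hlk /S; ring.
have hPQ : 'X_ix * (4%:R * P - k * 'X_ix * 'X_iz)
         + 'X_iy * (4%:R * Q - k * 'X_iy * 'X_iz) = 0.
  transitivity (4%:R * A - k * 'X_iz * ('X_ix ^+ 2 + 'X_iy ^+ 2)).
    by rewrite /A; ring.
  by rewrite hA subrr.
(* At y = 0 only the first summand of [hPQ] survives, and x cancels. So the factor of x is y g, and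
   cancelling y makes the factor of y equal to -x g. *)
have P0 : mzero iy (4%:R * P - k * 'X_ix * 'X_iz) = 0.
  move: hPQ; move: (4%:R * P - _) (4%:R * Q - _) => p q /(congr1 (mzero iy)).
  rewrite rmorph0 rmorphD !rmorphM /= !mzeroX /= mul0r addr0 => /eqP.
  by rewrite mulf_eq0 (negbTE (X0 _)) => /eqP.
have [g hg] := mzero_factor _ _ _ _ P0.
have hQg : 4%:R * Q - k * 'X_iy * 'X_iz = - ('X_ix * g).
  apply: (mulfI (X0 iy)); apply/eqP; rewrite -subr_eq0 -hPQ hg; apply/eqP; ring.
have g2 : (msize g <= 2)%N.
  apply: (@msize_cofactor _ _ 2 1 'X_iy); rewrite ?msizeU // -hg.
  apply: msizeD_leS; first exact: (@msizeM_leS _ _ 0 2).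
  rewrite msizeN; apply: (@msizeM_leS _ _ 1 1) => //.
  by apply: (@msizeM_leS _ _ 0 1); rewrite // hk0 msizeC_le1.
have h4 : (4%:R^-1)%:MP * 4%:R = 1 :> {mpoly R[3]}.
  by rewrite -mpolyC_nat -mpolyCM mulVf ?pnatr_eq0.
have h2 : (2%:R^-1)%:MP * 2%:R = 1 :> {mpoly R[3]}.
  by rewrite -mpolyC_nat -mpolyCM mulVf ?pnatr_eq0.
(* The number alpha is the constant in K = alpha z, and f is g / 4. *)
exists k0, ((4%:R^-1)%:MP * g); split.
- rewrite /linear_poly /pdeg -subn1 leq_subLR addn1.
  by apply: (@msizeM_leS _ _ 0 1) => //; rewrite msizeC_le1.
- rewrite -mul_mpolyC mpolyCM -hk0 -[LHS]mul1r -h4 -[_ * g * _]mulrA.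
  by rewrite [g * _]mulrC -hg; ring.
- rewrite -mul_mpolyC mpolyCM -hk0 -[LHS]mul1r -h4 -[_ * g * _]mulrA.
  by rewrite [g * _]mulrC -mulrN -hQg; ring.
(* Substituting l = k a^2 gives 2 W = k (z^2 - 1 - a^2 S), and -a^2 S contributes the a^4. *)
- have hW : 2%:R * W = k * ('X_iz ^+ 2 - 1) - l%:MP * S.
    transitivity (k * ('X_iz ^+ 2 - 1) - S * (4%:R * B - k * S)).
      by rewrite hl; ring.
    by rewrite hl0; ring.
  rewrite -!mul_mpolyC [in X in _ = X]mpolyCM -hk0 -[LHS]mul1r -h2 -[_ * _ * W]mulrA hW hlk.
  rewrite mpolyCB mpolyC1 mpolyCN !rmorphXn /= /S !rmorphXn /=; ring.
Qed.
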